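(* Let $T$ be a triangulation of a closed oriented surface such that each pair of triangles in $T$ have at most one side in common. Let $G$ be the dual trivalent graph of $T$, and suppose that $G$ has a Hamiltonian cycle. Let $\Delta_1,\dots,\Delta_N$ be the corresponding sequence of triangles in $T$ (all indexing of triangles and of the lines $\ell_i$ below is modulo $N$): consecutive triangles $\Delta_i$ and $\Delta_{i+1}$ are adjacent for every $i$, and each triangle in $T$ appears exactly once in the sequence. Then the following closure theorem holds. For each vertex $v$ in $T$, choose a different point $P_v$ on the real (resp. complex) projective plane. For each edge $e$ of $T$, with endpoints $u,v$, shared by two consecutive triangles $\Delta_i$ and $\Delta_{i+1}$, denote $\ell_i=(P_uP_v)$. For each of the remaining edges $e$ of $T$, with endpoints $u,v$, choose a point $P_e\in(P_uP_v)$. Pick a point $Q_1\in\ell_1$. Assume that all the chosen points are distinct. Recursively define points $Q_i\in\ell_i$, $i\ge2$, by $$Q_i=\ell_i\cap(Q_{i-1}P_e),$$ where $e$ is the unique side of the triangle $\Delta_i$ not shared with the triangles $\Delta_{i\pm1}$ (and assume that these intersections are well defined). Then $Q_{N+1}=Q_1$.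
   Context: $(XY)$ denotes the line through two distinct points $X,Y$. The dual graph of $T$ has a vertex for each triangle of $T$ and an edge joining two triangles for each side they share. An intersection $\ell_i\cap(Q_{i-1}P_e)$ is well defined if $Q_{i-1}\ne P_e$ and $\ell_i\neq(Q_{i-1}P_e)$. *)

(* Defs.v *)
From HB Require Import structures.
From mathcomp Require Import all_boot all_order all_algebra.
From mathcomp Require Import reals.
From mathcomp.real_closed Require Import complex.

Set Implicit Arguments.
Unset Strict Implicit.
Unset Printing Implicit Defensive.

Import GRing.Theory.

(* A triangulated closed oriented surface is encoded by its finite set of     *)
(* darts. A dart is a side of a triangle, directed by the orientation of the  *)
(* surface: [next] runs around the triangle, and [opp] maps a side to the     *)
(* oppositely directed side of the triangle that it is glued to. Gluing       *)
(* triangles along a fixed-point free involution of their sides always yields *)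
(* a closed oriented surface, and all of them arise in this way. Two vertices *)
(* may be joined by several edges, but no edge is a loop: a line (P_u P_v)    *)
(* through distinct points is attached to every edge uv. Connectedness is not *)
(* required; it follows from the existence of a Hamiltonian cycle in the dual *)
(* graph.                                                                     *)
Record triangulation := Triangulation {
  dart : finType;
  opp : dart -> dart;
  next : dart -> dart;
  oppK : involutive opp;
  opp_neq : forall d, opp d != d;
  next3 : forall d, next (next (next d)) = d;
  next_neq : forall d, next d != d;
  no_loop : forall d, ~~ fconnect (fun x => opp (next (next x))) d (opp d)
}.

Section Cells.
Variable T : triangulation.

(* The dart that follows d around the vertex at which d starts.               *)
Definition turn (d : dart T) : dart T := opp (next (next d)).

(* A vertex is the set of the darts that start at it, an edge is the pair of  *)
(* its two darts, and a triangle is the set of its three darts.               *)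
Definition vertex_of (d : dart T) : {set dart T} := [set x | fconnect turn d x].
Definition edge_of (d : dart T) : {set dart T} := [set d; opp d].
Definition triangle_of (d : dart T) : {set dart T} :=
  [set d; next d; next (next d)].

Definition vertices : {set {set dart T}} := [set vertex_of d | d : dart T].
Definition edges : {set {set dart T}} := [set edge_of d | d : dart T].
Definition triangles : {set {set dart T}} := [set triangle_of d | d : dart T].

Definition sides (t : {set dart T}) : {set {set dart T}} :=
  [set edge_of d | d in t].

Definition at_most_one_common_side : Prop :=
  forall t1 t2, t1 \in triangles -> t2 \in triangles -> t1 != t2 ->
  #|sides t1 :&: sides t2| <= 1.

(* Under [at_most_one_common_side] the dual graph has no multiple edges, so   *)
(* that it is determined by its adjacency relation.                           *)
Definition dual_graph : rel {set dart T} := fun t1 t2 =>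
  [&& t1 \in triangles, t2 \in triangles, t1 != t2
    & sides t1 :&: sides t2 != set0].

Definition hamiltonian_cycle (c : seq {set dart T}) : Prop :=
  [/\ 2 < size c, ucycle dual_graph c & c =i triangles].

Section Cycle.
Variable c : seq {set dart T}.

(* The sequence of triangles, indexed modulo N = size c; the list c is        *)
(* Delta_0, Delta_1, ..., Delta_(N-1), where Delta_0 = Delta_N.               *)
Definition Delta (i : nat) : {set dart T} := nth set0 c (i %% size c).

Definition the_element (A : {set {set dart T}}) : {set dart T} :=
  odflt set0 [pick e in A].

(* Both sets below are singletons, when i > 0, for a Hamiltonian cycle c in   *)
(* the dual graph of a triangulation with [at_most_one_common_side].          *)
Definition shared_side (i : nat) : {set dart T} :=
  the_element (sides (Delta i) :&: sides (Delta i.+1)).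
Definition third_side (i : nat) : {set dart T} :=
  the_element (sides (Delta i) :\: (sides (Delta i.-1) :|: sides (Delta i.+1))).

Definition remaining_edges : {set {set dart T}} :=
  edges :\: [set shared_side i | i : 'I_(size c)].

End Cycle.
End Cells.

(* Points of the projective plane over F are the lines through the origin of  *)
(* F^3; lines of the projective plane are two-dimensional subspaces.          *)
Record point (F : fieldType) := Point {
  point_space :> {vspace 'rV[F]_3};
  _ : \dim point_space == 1%N
}.
HB.instance Definition _ (F : fieldType) := [isSub for @point_space F].
HB.instance Definition _ (F : fieldType) := [Choice of point F by <:].

(* The line (XY) when X and Y are distinct.                                   *)
Definition line_through (F : fieldType) (X Y : point F) : {vspace 'rV[F]_3} :=
  (X + Y)%VS.

Section Closure.
Variables (F : fieldType) (T : triangulation) (c : seq {set dart T}).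

(* The line (P_u P_v), where u and v are the endpoints of the edge e.         *)
Definition edge_line (PV : {set dart T} -> point F) (e : {set dart T}) :
  {vspace 'rV[F]_3} := (\sum_(d in e) PV (vertex_of d))%VS.

(* PV is used only on vertices and PE only on the remaining edges. A point    *)
(* lies on a line when it is a subspace of it, and two distinct lines meet in *)
(* the point which is their intersection as subspaces. The value Q 0 is not   *)
(* used.                                                                      *)
Definition closure_theorem : Prop :=
  forall (PV PE : {set dart T} -> point F) (Q : nat -> point F),
  let N := size c in
  let ell i := edge_line PV (shared_side c i) in
  (forall e, e \in remaining_edges c -> (PE e <= edge_line PV e)%VS) ->
  (Q 1 <= ell 1)%VS ->
  uniq (Q 1 :: [seq PV v | v in vertices T]
            ++ [seq PE e | e in remaining_edges c]) ->
  (forall i, 2 <= i ->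
     let P_e := PE (third_side c i) in
     [/\ Q i.-1 != P_e,
         ell i != line_through (Q i.-1) P_e
       & Q i = (ell i :&: line_through (Q i.-1) P_e)%VS :> {vspace 'rV[F]_3}]) ->
  Q N.+1 = Q 1.

End Closure.

(* Main.v *)
From mathcomp Require Import all_boot all_order all_algebra.
From mathcomp Require Import reals.
From mathcomp.real_closed Require Import complex.
Require Import Defs.

Set Implicit Arguments.
Unset Strict Implicit.
Unset Printing Implicit Defensive.

Import GRing.Theory.

(** The theorem is a telescoping product of Menelaus relations, and it holds
over every field.

Fix a nonzero vector p_v in each P_v. A point X on the line of an edge,
different from its two endpoints, contains the vector p_u + l p_v for a unique
nonzero l, its ratio on the dart from u to v ([side_ratio]). On the opposite
dart the ratio of X is l^-1. If l, m, n are the ratios, on the three darts of a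
triangle, of three points of the sides of which the third lies on the line
through the other two, then l m n = -1 ([menelaus]).

The path of triangles leaves Delta_k through a dart s_k and enters Delta_(k+1)
through the opposite dart; let t_k be the third dart of Delta_(k+1) and g(t_k)
the ratio on it of the point P_e of its edge. Menelaus' relation in Delta_(k+1)
says that the ratio h_k of Q_k on s_k satisfies h_(k+1) = - h_k / g(t_k). After
one turn, h_(N+1) is h_1 times the product of the numbers - 1 / g(t_k). The
darts t_1, ..., t_N are all the darts of the remaining edges, each taken once
([prod_third_darts]). Each remaining edge contributes its two darts, on which
the values of g are inverse to each other, so the product is 1
([prod_fpfree_involution]); pairing the factors together with their signs also
accounts for the fact that the number N of triangles is even. Hence Q_1 and
Q_(N+1) have the same ratio on the same dart s_1 = s_(N+1), and are equal. *)

(** * Products over a fixed-point free involution *)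

(** The factors cancel in pairs. Comparing x with s x in an enumeration of the
index type selects one element of each pair; reindexing the whole product by s
would only show that its square is 1. *)
Lemma prod_fpfree_involution (F : fieldType) (I : finType) (s : I -> I)
    (D : pred I) (G : I -> F) :
    involutive s -> (forall x, s x != x) -> (forall x, D (s x) = D x) ->
    (forall x, D x -> (G x * G (s x) = 1)%R) ->
  (\prod_(x | D x) G x = 1)%R.
Proof.
move=> sK s_neq Ds Gs.
pose low x := enum_rank x < enum_rank (s x).
have low_s x : low (s x) = ~~ low x.
  rewrite /low sK -leqNgt ltn_neqAle andbC; case: leqP => //= _.
  by rewrite (inj_eq val_inj) (inj_eq enum_rank_inj) s_neq.
rewrite (bigID low) /= [X in (_ * X)%R](reindex_inj (inv_inj sK)) /=.
under [X in (_ * X)%R]eq_bigl => x do rewrite Ds low_s negbK.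
by rewrite -big_split big1 //= => x /andP[/Gs].
Qed.

(** * Darts, edges and triangles *)

Lemma the_element_eq (T : triangulation) (A : {set {set dart T}}) e :
  e \in A -> (forall e', e' \in A -> e' = e) -> the_element A = e.
Proof.
move=> Ae eqA; rewrite /the_element; case: pickP => [e' /eqA //|/(_ e)].
by rewrite Ae.
Qed.

Section Triangulation.
Variable T : triangulation.
Implicit Types (d : dart T) (t : {set dart T}).

Lemma mem_triangle_of d : d \in triangle_of d.
Proof. by rewrite !inE eqxx. Qed.

Lemma triangle_of_eq d d' : d \in triangle_of d' -> triangle_of d' = triangle_of d.
Proof.
rewrite !inE -orbA => /or3P[] /eqP-> //; apply/setP=> x; rewrite !inE next3;
  by case: (x == d'); case: (x == next d'); case: (x == next (next d')).
Qed.

Lemma triangles_eq t d : t \in triangles T -> d \in t -> t = triangle_of d.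
Proof. by case/imsetP=> d' _ -> /triangle_of_eq. Qed.

Lemma triangle_next t d : t \in triangles T -> d \in t -> next d \in t.
Proof. by move=> tT /(triangles_eq tT)->; rewrite !inE eqxx orbT. Qed.

Lemma next2_neq d : next (next d) != d.
Proof.
apply/eqP=> /(congr1 (@next T))/eqP.
by rewrite next3 eq_sym (negPf (next_neq d)).
Qed.

Lemma edge_of_opp d : edge_of (opp d) = edge_of d.
Proof. by rewrite /edge_of oppK setUC. Qed.

Lemma edge_of_eq d d' : edge_of d = edge_of d' -> d = d' \/ d = opp d'.
Proof.
move/setP/(_ d); rewrite !inE eqxx /= => /esym/orP[]/eqP; by [left | right].
Qed.

(** Both darts start where d ends: [opp d] is the [turn] of [next d]. *)
Lemma vertex_of_opp d : vertex_of (opp d) = vertex_of (next d).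
Proof.
apply/setP=> x; rewrite !inE.
have turn_inj : injective (@turn T).
  move=> a b /(inv_inj (@oppK T)) eq_ab.
  by rewrite -(next3 a) -(next3 b) eq_ab.
have ->: opp d = turn (next d) by rewrite /turn next3.
by rewrite -(same_fconnect1 turn_inj).
Qed.

Lemma vertex_of_opp_neq d : vertex_of (opp d) != vertex_of d.
Proof.
apply/eqP=> /setP/(_ (opp d)); rewrite !inE connect0 => /esym.
by apply/negP; exact: no_loop.
Qed.

End Triangulation.

(** * The darts met by a Hamiltonian cycle *)

Section HamiltonianCycle.
Variables (T : triangulation) (c : seq {set dart T}).
Hypothesis one_side : at_most_one_common_side T.
Hypothesis ham : hamiltonian_cycle c.
Local Notation N := (size c).
Local Notation Delta := (Delta c).

Lemma size_gt0 : 0 < N.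
Proof. by case: ham => /(leq_trans _)->. Qed.

Lemma Delta_triangle i : Delta i \in triangles T.
Proof.
by case: ham => _ _ <-; rewrite mem_nth ?ltn_pmod ?size_gt0.
Qed.

Lemma Delta_inj i j : Delta i = Delta j -> i = j %[mod N].
Proof.
move=> eqij; case: ham => _ /andP[_ Uc] _.
by apply/eqP; rewrite -(nth_uniq set0 _ _ Uc) ?ltn_pmod ?size_gt0 //; apply/eqP.
Qed.

(** The window [a, a + N) of indices is left free because the construction
crosses Delta_2, ..., Delta_(N+1) rather than Delta_0, ..., Delta_(N-1). *)
Lemma Delta_exists t a : t \in triangles T ->
  exists2 i, i \in iota a N & Delta i = t.
Proof.
case: ham => _ _ <- /(nthP set0)[j j_lt <-].
(* a + r is the representative of j modulo N that lies in [a, a + N) *)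
pose r := (j + (N - a %% N)) %% N.
exists (a + r).
  by rewrite mem_iota leq_addr ltn_add2l ltn_pmod // size_gt0.
congr (nth _ _ _); rewrite modnDmr -modnDml addnCA subnKC.
  by rewrite modnDr modn_small.
exact: (ltnW (ltn_pmod _ size_gt0)).
Qed.

Lemma Delta_adjacent i : dual_graph (Delta i) (Delta i.+1).
Proof.
case: ham => _ /andP[]; rewrite /Defs.Delta.
have := ltn_pmod i size_gt0; rewrite -(addn1 i) -modnDml addn1.
case: c (i %% _) => //= x p k k_lt /(pathP set0) /(_ k).
rewrite size_rcons -rcons_cons nth_rcons /= k_lt => /(_ isT) + _.
move: k_lt; rewrite nth_rcons ltnS leq_eqVlt => /predU1P[-> | k_lt].
  by rewrite ltnn eqxx modnn.
by rewrite k_lt modn_small.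
Qed.

Lemma Delta_neq i : Delta i != Delta i.+1.
Proof. by case/and4P: (Delta_adjacent i). Qed.

(** This is where a cycle of length 2 has to be excluded: it would enter and
leave a triangle through the same side. *)
Lemma Delta_neq2 i : Delta i != Delta i.+2.
Proof.
apply/eqP=> /Delta_inj/eqP; rewrite -addn2 -{1}(addn0 i) eqn_modDl mod0n.
by case: ham => N_gt2 _ _; rewrite modn_small.
Qed.

Lemma shared_side_uniq i e : e \in sides (Delta i) -> e \in sides (Delta i.+1) ->
  shared_side c i = e.
Proof.
move=> ei ei1; apply: the_element_eq => [|e' e'P]; first by rewrite inE ei.
have /card_le1_eqP := one_side (Delta_triangle i) (Delta_triangle i.+1) (Delta_neq i).
by apply=> //; rewrite inE ei.
Qed.

Lemma Delta_mem_eq i j d : d \in Delta i -> d \in Delta j -> Delta i = Delta j.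
Proof.
move=> /(triangles_eq (Delta_triangle i))-> /(triangles_eq (Delta_triangle j))->.
by [].
Qed.

(** The two copies of the shared edge lie in different triangles, since a
dart belongs to one triangle only; so the edge yields a dart of Delta_i whose
opposite is in Delta_(i+1). *)
Lemma exit_dart_exists i :
  exists d, [&& d \in Delta i, opp d \in Delta i.+1 & edge_of d == shared_side c i].
Proof.
have /and4P[_ _ _ /set0Pn[e]] := Delta_adjacent i; rewrite inE => /andP[ei ei1].
rewrite (shared_side_uniq ei ei1).
case/imsetP: ei ei1 => d d_in -> /imsetP[d' d'_in /edge_of_eq eq_d].
exists d; rewrite d_in eqxx andbT /=; case: eq_d => eq_d; last by rewrite eq_d oppK.
case/eqP: (Delta_neq i); apply: Delta_mem_eq d_in _; by rewrite eq_d.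
Qed.

Definition exit_dart i : dart T := xchoose (exit_dart_exists i).

Lemma exit_dartP i :
  [/\ exit_dart i \in Delta i, opp (exit_dart i) \in Delta i.+1
    & edge_of (exit_dart i) = shared_side c i].
Proof. by have /and3P[? ? /eqP] := xchooseP (exit_dart_exists i). Qed.

Lemma exit_dart_mod i j : i = j %[mod N] -> exit_dart i = exit_dart j.
Proof.
move=> eqij; have eqij1 : i.+1 = j.+1 %[mod N].
  by apply/eqP; rewrite -!(addn1 i, addn1 j) eqn_modDr eqij.
apply: eq_xchoose => d.
by rewrite /shared_side /Defs.Delta eqij eqij1.
Qed.

Lemma shared_side_eq d i : edge_of d = shared_side c i ->
  d = exit_dart i \/ d = opp (exit_dart i).
Proof. by have [_ _ <-] := exit_dartP i; apply: edge_of_eq. Qed.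

(** If Delta_(k+1) were left through the side by which it was entered, the dart
[exit_dart k] would lie both in Delta_k and in Delta_(k+2). *)
Lemma exit_dart_neq k : exit_dart k.+1 != opp (exit_dart k).
Proof.
have [k0 _ _] := exit_dartP k; have [_ k1 _] := exit_dartP k.+1.
apply: contraNneq (Delta_neq2 k) => eq_k; apply/eqP/(Delta_mem_eq k0).
by rewrite -(oppK (exit_dart k)) -eq_k.
Qed.

(** The third dart of Delta_(k+1), not of Delta_k: the index k is that of the
point Q_k, which is projected to Q_(k+1) from a point of the third side. *)
Definition third_dart k : dart T :=
  let d := next (opp (exit_dart k)) in if exit_dart k.+1 == d then next d else d.

(** The cycle turns right or left in each triangle; in cyclic order the three
darts are then entry, exit, third or entry, third, exit. *)
Lemma third_dart_cases k (entry := opp (exit_dart k)) :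
  exit_dart k.+1 = next entry /\ third_dart k = next (next entry)
  \/ exit_dart k.+1 = next (next entry) /\ third_dart k = next entry.
Proof.
rewrite /third_dart -/entry; case: eqP => [-> | /eqP neq1]; [by left | right].
have [_ entry_in _] := exit_dartP k; have [exit_in _ _] := exit_dartP k.+1.
move: exit_in; rewrite (triangles_eq (Delta_triangle _) entry_in) !inE.
by rewrite (negPf neq1) (negPf (exit_dart_neq k)) => /eqP.
Qed.

Lemma mem_third_dart k : third_dart k \in Delta k.+1.
Proof.
have [_ entry_in _] := exit_dartP k; have tT := Delta_triangle k.+1.
by case: (third_dart_cases k) => -[_ ->]; do !apply: triangle_next => //.
Qed.

Lemma third_dart_neq_exit k : third_dart k != exit_dart k.+1.
Proof.
by case: (third_dart_cases k) => -[-> ->]; rewrite ?next_neq // eq_sym next_neq.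
Qed.

Lemma third_dart_neq_entry k : third_dart k != opp (exit_dart k).
Proof.
by case: (third_dart_cases k) => -[_ ->]; rewrite ?next_neq ?next2_neq.
Qed.

Lemma Delta_darts k d : d \in Delta k.+1 ->
  [\/ d = opp (exit_dart k), d = exit_dart k.+1 | d = third_dart k].
Proof.
have [_ entry_in _] := exit_dartP k.
rewrite (triangles_eq (Delta_triangle _) entry_in) !inE -orbA.
case: (third_dart_cases k) => -[-> ->] /or3P[] /eqP->;
  by [constructor 1 | constructor 2 | constructor 3].
Qed.

(** A shared edge consists of an exit dart and its opposite, an entry dart.
The third dart of a triangle is neither the exit nor the entry dart of that
triangle, and those of other triangles do not lie in it. *)
Lemma third_dart_not_shared k i : edge_of (third_dart k) != shared_side c i.
Proof.
have t_in := mem_third_dart k; have [i_in i_in1 _] := exit_dartP i.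
apply/eqP=> /shared_side_eq[] eq_t; move: (t_in); rewrite eq_t => e_in.
  case/eqP: (third_dart_neq_exit k); rewrite eq_t; apply/exit_dart_mod/Delta_inj.
  exact: Delta_mem_eq e_in.
case/eqP: (third_dart_neq_entry k); rewrite eq_t; congr opp; apply: exit_dart_mod.
have /Delta_inj/eqP := Delta_mem_eq i_in1 e_in.
by rewrite -(addn1 i) -(addn1 k) eqn_modDr => /eqP.
Qed.

Lemma third_sideE k : third_side c k.+1 = edge_of (third_dart k).
Proof.
have t_side : edge_of (third_dart k) \in sides (Delta k.+1).
  exact: imset_f (mem_third_dart k).
have [k_in _ _] := exit_dartP k; have [_ k1_in1 _] := exit_dartP k.+1.
apply: the_element_eq => [|e].
  rewrite !inE t_side andbT negb_or; apply/andP; split; apply/negP=> e_in.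
    by case/eqP: (third_dart_not_shared k k); rewrite (shared_side_uniq e_in).
  by case/eqP: (third_dart_not_shared k k.+1); rewrite (shared_side_uniq t_side).
rewrite !inE negb_or -andbA => /and3P[/negP no_k /negP no_k2] /imsetP[d d_in eq_e].
case: (Delta_darts d_in) => eq_d; rewrite eq_e eq_d // in no_k no_k2 *.
  by case: no_k; rewrite edge_of_opp; apply: imset_f.
by case: no_k2; rewrite -edge_of_opp; apply: imset_f.
Qed.

Lemma third_dart_remaining k : edge_of (third_dart k) \in remaining_edges c.
Proof.
rewrite inE (imset_f (@edge_of T)) // andbT; apply/imsetP=> -[i _ /eqP].
by apply/negP/third_dart_not_shared.
Qed.

Lemma shared_side_not_remaining i : shared_side c i \notin remaining_edges c.
Proof.
rewrite inE negb_and negbK; apply/orP; left; apply/imsetP.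
exists (Ordinal (ltn_pmod i size_gt0)) => //=.
have [_ _ <-] := exit_dartP i; have [_ _ <-] := exit_dartP (i %% N).
by congr edge_of; apply: exit_dart_mod; rewrite modn_mod.
Qed.

(** A triangle of the cycle contains exactly one dart of a remaining edge,
since its entry and exit darts carry shared edges; and the indices 1, ..., N
meet each triangle once. *)
Lemma prod_third_darts (F : fieldType) (G : dart T -> F) :
  (\prod_(k <- iota 1 N) G (third_dart k)
   = \prod_(d | edge_of d \in remaining_edges c) G d)%R.
Proof.
rewrite -[RHS]big_filter -(big_map third_dart xpredT G); apply: perm_big.
apply: uniq_perm => [||d].
- rewrite map_inj_in_uniq ?iota_uniq // => i j; rewrite !mem_iota.
  move=> /andP[i_gt i_lt] /andP[j_gt j_lt] eq_t.
  have := mem_third_dart i; rewrite eq_t => t_in.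
  have /Delta_inj/eqP := Delta_mem_eq t_in (mem_third_dart j).
  rewrite -(prednK i_gt) -(prednK j_gt) -addn2 -[X in _ == X %[mod _]]addn2.
  rewrite eqn_modDr !modn_small; last 2 first.
  - by rewrite -(ltn_add2l 1) !add1n prednK.
  - by rewrite -(ltn_add2l 1) !add1n prednK.
  by move=> /eqP ->.
- by rewrite filter_uniq // index_enum_uniq.
rewrite mem_filter mem_index_enum andbT; apply/mapP/idP => [[k _ ->] | d_rem].
  exact: third_dart_remaining.
have tT : triangle_of d \in triangles T by apply: imset_f.
have [i i_in eq_i] := Delta_exists 2 tT.
case: i i_in eq_i => [|i] i_in eq_i; first by rewrite mem_iota in i_in.
exists i.
  by move: i_in; rewrite !mem_iota.
have d_in : d \in Delta i.+1 by rewrite eq_i mem_triangle_of.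
have rem_exit j : edge_of (exit_dart j) \notin remaining_edges c.
  by have [_ _ ->] := exit_dartP j; apply: shared_side_not_remaining.
case: (Delta_darts d_in) => // eq_d; move: d_rem; rewrite eq_d ?edge_of_opp.
  by rewrite (negPf (rem_exit i)).
by rewrite (negPf (rem_exit i.+1)).
Qed.

End HamiltonianCycle.

(** * Ratios on the sides of triangles and the theorem of Menelaus *)

Section SideRatios.
Local Open Scope ring_scope.
Variables (F : fieldType) (T : triangulation) (PV : {set dart T} -> point F).
Implicit Types (d : dart T) (X Y Z : point F) (l m : F).

Lemma vpick_point_neq0 X : vpick X != 0.
Proof. by case: X => V /= /eqP V1; rewrite vpick0 -dimv_eq0 V1. Qed.

Lemma point_eq X Y v :
  v != 0 -> v \in (X : {vspace _}) -> v \in (Y : {vspace _}) -> X = Y.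
Proof.
have line Z : v != 0 -> v \in (Z : {vspace _}) -> Z = <[v]>%VS :> {vspace _}.
  case: Z => V /= /eqP V1 v0 vV; apply/eqP.
  by rewrite eq_sym eqEdim -memvE vV dim_vline v0 V1.
by move=> v0 vX vY; apply: val_inj; rewrite /= (line X v0 vX) (line Y v0 vY).
Qed.

Lemma mem_point X v : v \in (X : {vspace _}) -> exists k, v = k *: vpick X.
Proof.
move=> vX; apply/vlineP; suff <-: X = <[vpick X]>%VS :> {vspace _} by [].
apply/eqP; rewrite eq_sym eqEdim -memvE memv_pick dim_vline vpick_point_neq0.
by case: X vX => V /= /eqP->.
Qed.

(** The endpoint at which d starts; the other one is [endpoint (opp d)]. *)
Definition endpoint d : 'rV[F]_3 := vpick (PV (vertex_of d)).

(** The ratio is a relation rather than a function of d and X, so that no value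
has to be chosen off the line of d; l != 0 makes it symmetric under [opp]. *)
Definition side_ratio d X l : bool :=
  (l != 0) && (endpoint d + l *: endpoint (opp d) \in (X : {vspace _})).

Lemma side_ratio_opp d X l : side_ratio d X l -> side_ratio (opp d) X l^-1.
Proof.
case/andP=> l0 dX; rewrite /side_ratio invr_eq0 l0 oppK.
have := memvZ l^-1 dX; rewrite scalerDr scalerA mulVf // scale1r.
by rewrite addrC.
Qed.

Lemma side_ratio_exists d X :
  (X <= edge_line PV (edge_of d))%VS -> X != PV (vertex_of d) ->
  X != PV (vertex_of (opp d)) -> exists l, side_ratio d X l.
Proof.
rewrite /edge_line /edge_of big_setU1 ?big_set1 /=; last first.
  by rewrite inE eq_sym opp_neq.
move=> /subvP/(_ _ (memv_pick X))/memv_addP[_ /mem_point[a ->]].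
case=> _ /mem_point[b ->] eqX; rewrite -!/(endpoint _) in eqX *.
have X0 := vpick_point_neq0 X; have pX := memv_pick X => /eqP neq1 /eqP neq2.
have a0 : a != 0.
  apply: contra_notN neq2 => /eqP a0; apply: (point_eq X0 pX).
  by rewrite eqX a0 scale0r add0r memvZ // memv_pick.
have b0 : b != 0.
  apply: contra_notN neq1 => /eqP b0; apply: (point_eq X0 pX).
  by rewrite eqX b0 scale0r addr0 memvZ // memv_pick.
exists (a^-1 * b); rewrite /side_ratio mulf_neq0 ?invr_eq0 //=.
by rewrite -scalerA -{1}[endpoint d](scalerK a0) -scalerDr -eqX memvZ.
Qed.

Lemma side_ratio_inj d X l m :
  X != PV (vertex_of (opp d)) -> side_ratio d X l -> side_ratio d X m -> l = m.
Proof.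
move=> /eqP neqX /andP[_ lX] /andP[_ mX]; apply/eqP; rewrite -subr_eq0.
apply: contra_notT neqX => lm0.
apply: (@point_eq _ _ (endpoint (opp d))); rewrite ?vpick_point_neq0 ?memv_pick //.
rewrite -[endpoint _](scalerK lm0) memvZ //; have := memvB lX mX.
by rewrite opprD addrACA subrr add0r -scalerBl.
Qed.

Lemma side_ratio_point_inj d X Y l :
  PV (vertex_of d) != PV (vertex_of (opp d)) ->
  side_ratio d X l -> side_ratio d Y l -> X = Y.
Proof.
move=> /eqP neqP /andP[_ lX] /andP[_ lY]; apply: point_eq lX lY.
apply: contra_notN neqP; rewrite addr_eq0 => /eqP eqd.
apply: (@point_eq _ _ (endpoint d)); rewrite ?vpick_point_neq0 ?memv_pick //.
by rewrite eqd rpredN memvZ // memv_pick.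
Qed.

(** With p, q, r the vectors at the three vertices, the intersection Z contains
r - (l m)^-1 p, because this is a combination of the vector p + l q of X and
the vector q + m r of Y. The argument is the same for a degenerate triangle. *)
Lemma menelaus d X Y Z l m :
  side_ratio d X l -> side_ratio (next d) Y m ->
  Z = (edge_line PV (edge_of (next (next d))) :&: line_through X Y)%VS :> {vspace _} ->
  side_ratio (next (next d)) Z (- (l * m)^-1).
Proof.
have opp_next x : endpoint (opp x) = endpoint (next x).
  by rewrite /endpoint vertex_of_opp.
case/andP=> l0 lX /andP[m0 mY] eqZ.
rewrite /side_ratio oppr_eq0 invr_eq0 mulf_neq0 //= eqZ memv_cap.
apply/andP; split.
  rewrite /edge_line /edge_of big_setU1 ?big_set1 /=; last by rewrite inE eq_sym opp_neq.
  by apply: memv_add; rewrite ?memvZ // memv_pick.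
move: lX mY; rewrite !opp_next next3 => lX mY.
have -> : endpoint (next (next d)) + - (l * m)^-1 *: endpoint d =
   - (l * m)^-1 *: (endpoint d + l *: endpoint (next d))
   + m^-1 *: (endpoint (next d) + m *: endpoint (next (next d))).
  rewrite !scalerDr !scalerA mulVf // scale1r invfM mulNr mulrAC mulVf // mul1r.
  by rewrite [- m^-1 *: _]scaleNr addrA subrK addrC.
by apply: memv_add; apply: memvZ.
Qed.

End SideRatios.

(** * The closure theorem *)

Lemma closure_theorem_field (F : fieldType) (T : triangulation)
    (c : seq {set dart T}) :
  at_most_one_common_side T -> hamiltonian_cycle c -> closure_theorem F c.
Proof.
move=> one ham PV PE Q N ell PE_on Q1_on /= /andP[Q1_notin] Upts Qdef.
move: Q1_notin Upts; rewrite mem_cat cat_uniq negb_or.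
move=> /andP[Q1_PV _] /and3P[UPV PV_PE _].
have vertexT d : vertex_of d \in vertices T by apply: imset_f.
have PV_inj d : PV (vertex_of d) != PV (vertex_of (opp d)).
  apply: contraNneq (vertex_of_opp_neq d) => eq_PV; apply/eqP/esym.
  by move/dinjectiveP: UPV; apply.
have PE_PV d e : e \in remaining_edges c -> PE e != PV (vertex_of d).
  move=> e_rem; apply: contraNneq PV_PE => eq_e; apply/hasP; exists (PE e).
    by apply: image_f.
  by rewrite eq_e; apply: image_f.
have Q1_neq d : Q 1 != PV (vertex_of d).
  by apply: contraNneq Q1_PV => ->; apply: image_f.
pose S := @side_ratio F T PV.
have /fin_all_exists[g gS] : forall d : dart T, exists l : F,
    edge_of d \in remaining_edges c -> S d (PE (edge_of d)) l.
  move=> d; case: (boolP (edge_of d \in remaining_edges c)) => [d_rem | _]; last first.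
    by exists 0%R.
  have [l dl] := side_ratio_exists (PE_on _ d_rem) (PE_PV d _ d_rem)
                   (PE_PV (opp d) _ d_rem).
  by exists l.
have g_opp d : edge_of d \in remaining_edges c -> (- (g d)^-1 * - (g (opp d))^-1 = 1)%R.
  move=> d_rem; have dl := gS d d_rem.
  have d'_rem : edge_of (opp d) \in remaining_edges c by rewrite edge_of_opp.
  have d'l := gS _ d'_rem; rewrite edge_of_opp in d'l.
  have -> : g (opp d) = ((g d)^-1)%R.
    by apply: side_ratio_inj d'l (side_ratio_opp dl); rewrite oppK PE_PV.
  by rewrite mulrNN invrK mulVf //; case/andP: dl.
pose s := exit_dart one ham; pose t := third_dart one ham.
have ell_exit i : ell i = edge_line PV (edge_of (s i)).
  by have [_ _ ->] := exit_dartP one ham i.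
have [h1 Q1_ratio] : exists l, S (s 1) (Q 1) l.
  by apply: side_ratio_exists; rewrite ?Q1_neq // -ell_exit.
have Q_ratio k : S (s k.+1) (Q k.+1) (h1 * \prod_(i <- iota 1 k) - (g (t i))^-1)%R.
  elim: k => [|k IHk]; first by rewrite big_nil mulr1.
  rewrite -[in iota 1 k.+1](addn1 k) iotaD big_cat big_seq1 add1n mulrA.
  set h := (h1 * _)%R in IHk *.
  have [_ _] := Qdef k.+2 isT; rewrite /= third_sideE // -/(t k.+1) ell_exit => Qk.
  have PE_ratio := gS _ (third_dart_remaining one ham k.+1).
  have -> : (h * - (g (t k.+1))^-1 = - (h^-1 * g (t k.+1))^-1)%R.
    by rewrite mulrN invfM invrK.
  have := side_ratio_opp IHk; set entry := opp _ => entry_ratio.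
  case: (third_dart_cases one ham k.+1) => -[]; rewrite -/(s _) -/(t _) -/entry.
    (* the cyclic order is third, entry, exit, so the given points are P_e, Q *)
    move=> s_eq t_eq; have next_t : next (t k.+1) = entry by rewrite t_eq next3.
    rewrite s_eq -next_t mulrC; apply: (menelaus (Y := Q k.+1) PE_ratio);
      rewrite next_t //.
    by rewrite -s_eq /line_through addvC.
  (* the cyclic order is entry, third, exit *)
  move=> s_eq t_eq; rewrite s_eq; apply: (menelaus entry_ratio); rewrite -t_eq.
    exact: PE_ratio.
  by rewrite t_eq -s_eq.
have sN : s N.+1 = s 1.
  by apply: exit_dart_mod; rewrite -add1n modnDr.
apply: (side_ratio_point_inj (PV_inj (s 1)) _ Q1_ratio).
have := Q_ratio N; rewrite sN.
rewrite (prod_third_darts one ham (fun d => - (g d)^-1)%R).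
rewrite (prod_fpfree_involution (@oppK T) (@opp_neq T)) ?mulr1 //.
by move=> d; rewrite edge_of_opp.
Qed.

Theorem theorem8p7 (R : realType) (T : triangulation)
    (c : seq {set dart T}) :
  at_most_one_common_side T ->
  hamiltonian_cycle c ->
  closure_theorem R c /\ closure_theorem (complex R) c.
Proof. by move=> one ham; split; apply: closure_theorem_field. Qed.
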